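(* Let $\mathbb{F}$ be a field and let $m,d$ be integers with $\left[\frac{m-1}{2}\right]\le d\le m-1$. Then the $\widetilde{D}$-minimal simplicial complexes (over $\mathbb{F}$) in $\Sigma(m,d)$ are exactly all the taut simplicial complexes (over $\mathbb{F}$) in $\Sigma(m,d)$.
   Context: $[x]$ denotes the integer part (floor) of $x$. A finite simplicial complex $K$ with vertex set $V(K)=[m]=\{v_1,\dots,v_m\}$ ($m\ge 0$) contains $\varnothing$ and every singleton $\{v_i\}$ as a face; for $m=0$, $K=\{\varnothing\}$ is the irrelevant complex, of dimension $-1$. For $d<m$, $\Sigma(m,d)$ is the set of all $d$-dimensional simplicial complexes with vertex set $[m]$; $\{\varnothing\}$ is the only element of $\Sigma(0,-1)$. For a field $\mathbb{F}$, $\mathbb{F}[K]=\mathbb{F}[v_1,\dots,v_m]/\mathcal{I}_K$ is the Stanley-Reisner ring, where $\mathcal{I}_K$ is generated by the squarefree monomials corresponding to non-faces of $K$, and $\widetilde{D}(K;\mathbb{F})=\dim_{\mathbb{F}}\mathrm{Tor}_{\mathbb{F}[v_1,\dots,v_m]}(\mathbb{F}[K],\mathbb{F})$ is its total Betti number; equivalently (Hochster's formula) $\widetilde{D}(K;\mathbb{F})=\sum_{J\subseteq[m]}\sum_{i\ge -1}\dim_{\mathbb{F}}\widetilde{H}_i(K|_J;\mathbb{F})$, where $K|_J$ is the full subcomplex on $J$ and $\widetilde{H}_{-1}(\{\varnothing\};\mathbb{F})=\mathbb{F}$ is the only nonzero reduced homology group of $\{\varnothing\}$. A complex $K\in\Sigma(m,d)$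 is $\widetilde{D}$-minimal over $\mathbb{F}$ if $\widetilde{D}(K;\mathbb{F})=\min_{L\in\Sigma(m,d)}\widetilde{D}(L;\mathbb{F})$. A complex $K$ with $m$ vertices is taut over $\mathbb{F}$ if $\widetilde{D}(K;\mathbb{F})=2^{m-\dim(K)-1}$. *)

(* Defs.v *)
From HB Require Import structures.
From mathcomp Require Import all_boot all_order all_algebra.
From mathcomp Require Import ring_quotient mpoly.
From Stdlib Require Import ClassicalEpsilon.

Set Implicit Arguments.
Unset Strict Implicit.
Unset Printing Implicit Defensive.

Import GRing.Theory.

Local Open Scope ring_scope.

Record simplicial_complex (m : nat) := SimplicialComplex {
  faces : {set {set 'I_m}};
  face0 : set0 \in faces;
  face1 : forall i : 'I_m, [set i] \in faces;
  face_sub : forall s t : {set 'I_m}, t \subset s -> s \in faces -> t \in faces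
}.

(* An integer, since the irrelevant complex has dimension -1. *)
Definition cdim (m : nat) (K : simplicial_complex m) : int :=
  (\max_(s in faces K) #|s|)%:Z - 1.

Section StanleyReisner.

Variables (F : fieldType) (m : nat) (K : simplicial_complex m).

Definition in_SR_ideal (p : {mpoly F[m]}) : Prop :=
  exists g : {set 'I_m} -> {mpoly F[m]},
    p = \sum_(J : {set 'I_m} | J \notin faces K) g J * \prod_(i in J) 'X_i.

(* The quotient construction of the library takes a boolean predicate. *)
Definition SR_ideal : {pred {mpoly F[m]}} :=
  fun p => if excluded_middle_informative (in_SR_ideal p) then true else false.

Lemma SR_idealP (p : {mpoly F[m]}) : reflect (in_SR_ideal p) (p \in SR_ideal).
Proof.
by rewrite /in_mem /= /SR_ideal; case: excluded_middle_informative => h;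
  constructor.
Qed.

Lemma SR_ideal_closed : idealr_closed SR_ideal.
Proof.
split.
- by apply/SR_idealP; exists (fun=> 0); rewrite big1 // => J _; rewrite mul0r.
- apply/SR_idealP => -[g /(congr1 (meval (fun=> 0)))].
  rewrite rmorph1 rmorph_sum big1 => [/eqP|J JK]; first by rewrite oner_eq0.
  have /set0Pn[i iJ] : J != set0.
    by apply: contraNneq JK => ->; exact: face0.
  by rewrite rmorphM rmorph_prod (bigD1 i) //= mevalXU mul0r mulr0.
- move=> a u v /SR_idealP[g ->] /SR_idealP[h ->]; apply/SR_idealP.
  exists (fun J => a * g J + h J).
  rewrite mulr_sumr -big_split /=; apply: eq_bigr => J _.
  by rewrite mulrDl mulrA.
Qed.

HB.instance Definition _ :=
  isIdealr.Build {mpoly F[m]} SR_ideal SR_ideal_closed.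

Definition SR_ring : Type := {ideal_quot SR_ideal}.

HB.instance Definition _ := GRing.ComNzRing.copy SR_ring {ideal_quot SR_ideal}.

Definition SR_pi : {mpoly F[m]} -> SR_ring := (\pi_{ideal_quot SR_ideal})%qT.

HB.instance Definition _ :=
  GRing.RMorphism.copy SR_pi (\pi_{ideal_quot SR_ideal})%qT.

Definition SR_scale (c : F) (a : SR_ring) : SR_ring := SR_pi c%:MP * a.

Lemma SR_scaleA c d a : SR_scale c (SR_scale d a) = SR_scale (c * d) a.
Proof. by rewrite /SR_scale mulrA -rmorphM -rmorphM. Qed.

Lemma SR_scale1 : left_id 1 SR_scale.
Proof. by move=> a; rewrite /SR_scale !rmorph1 mul1r. Qed.

Lemma SR_scaleDr : right_distributive SR_scale +%R.
Proof. by move=> c a b; rewrite /SR_scale mulrDr. Qed.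

Lemma SR_scaleDl a : {morph SR_scale^~ a : c d / c + d}.
Proof. by move=> c d; rewrite /SR_scale !rmorphD mulrDl. Qed.

HB.instance Definition _ := GRing.Zmodule_isLmodule.Build F SR_ring
  SR_scaleA SR_scale1 SR_scaleDr SR_scaleDl.

Lemma SR_scaleAl c (a b : SR_ring) : c *: (a * b) = c *: a * b.
Proof. exact: mulrA. Qed.

HB.instance Definition _ := GRing.Lmodule_isLalgebra.Build F SR_ring SR_scaleAl.

HB.instance Definition _ := GRing.Lalgebra_isComAlgebra.Build F SR_ring.

End StanleyReisner.

Section Koszul.

Variables (m : nat) (A : comNzRingType) (x : 'I_m -> A).

(* A chain f is the sum of the f J e_J, where e_J is the basis element of the
   exterior algebra over A on e_1, .., e_m indexed by J, listed increasingly;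
   the differential is the antiderivation sending e_i to x i.  The homological
   degree of e_J is #|J|; all degrees are kept together. *)
Definition koszul_sign (J : {set 'I_m}) (i : 'I_m) : A :=
  (-1) ^+ #|[set j in J | (j < i)%N]|.

Definition koszul_d (f : {ffun {set 'I_m} -> A}) : {ffun {set 'I_m} -> A} :=
  [ffun J : {set 'I_m} =>
     \sum_(i | i \notin J) koszul_sign J i * x i * f (i |: J)].

Lemma koszul_sign_gt (J : {set 'I_m}) (i j : 'I_m) :
  (i < j)%N -> koszul_sign (j |: J) i = koszul_sign J i.
Proof.
move=> ij; rewrite /koszul_sign; congr (_ ^+ _); apply: eq_card => k.
rewrite !inE; case: eqP => [->|//].
by rewrite ltnNge (ltnW ij) !andbF.
Qed.

Lemma koszul_sign_lt (J : {set 'I_m}) (i j : 'I_m) :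
  (i < j)%N -> i \notin J -> koszul_sign (i |: J) j = - koszul_sign J j.
Proof.
move=> ij iJ; rewrite /koszul_sign -[RHS]mulN1r -exprS; congr (_ ^+ _).
have -> : [set k in i |: J | (k < j)%N] = i |: [set k in J | (k < j)%N].
  by apply/setP=> k; rewrite !inE; case: eqP => [->|//]; rewrite ij.
by rewrite cardsU1 inE (negPf iJ).
Qed.

Lemma koszul_dd (f : {ffun {set 'I_m} -> A}) : koszul_d (koszul_d f) = 0.
Proof.
apply/ffunP=> J; rewrite !ffunE.
pose T i j := koszul_sign J i * x i * (koszul_sign (i |: J) j * x j *
  f (j |: (i |: J))).
have TN (i j : 'I_m) : i \notin J -> (i < j)%N -> T j i = - T i j.
  move=> iJ ij; rewrite /T koszul_sign_gt // koszul_sign_lt // setUCA.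
  by rewrite !mulNr mulrN opprK mulrCA.
transitivity (\sum_(i | i \notin J) (\sum_(j | (j \notin J) && (i < j)%N) T i j
   + \sum_(j | (j \notin J) && (j < i)%N) T i j)).
  apply: eq_bigr => i iJ; rewrite ffunE mulr_sumr.
  rewrite (bigID (fun j : 'I_m => (i < j)%N)) /=.
  congr (_ + _); apply: eq_bigl => j; rewrite !inE negb_or -val_eqE /=;
    by case: (j \in J); case: (ltngtP i j).
rewrite big_split /= [X in _ + X](exchange_big_dep (fun j => j \notin J)) /=;
  last by move=> i j _ /andP[].
rewrite -big_split big1 //= => i iJ.
rewrite [X in X + _](eq_bigr (fun j => - T j i)) => [|j /andP[jJ ij]]; last first.
  by rewrite (TN i j) // opprK.
rewrite sumrN; apply/eqP; rewrite addrC subr_eq0; apply/eqP/eq_bigl => j.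
by rewrite iJ.
Qed.

Lemma koszul_dD (f g : {ffun {set 'I_m} -> A}) :
  koszul_d (f + g) = koszul_d f + koszul_d g.
Proof.
apply/ffunP=> J; rewrite !ffunE -big_split; apply: eq_bigr => i _ /=.
by rewrite ffunE mulrDr.
Qed.

Lemma koszul_dB (f g : {ffun {set 'I_m} -> A}) :
  koszul_d (f - g) = koszul_d f - koszul_d g.
Proof.
apply/ffunP=> J; rewrite !ffunE -sumrB; apply: eq_bigr => i _ /=.
by rewrite !ffunE mulrBr.
Qed.

Definition regular_sequence : Prop := forall (k : 'I_m) (a : 'I_m -> A) (b : A),
  x k * b = \sum_(i < m | (i < k)%N) x i * a i ->
  exists a', b = \sum_(i < m | (i < k)%N) x i * a' i.

Let supported k (f : {ffun {set 'I_m} -> A}) :=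
  forall (J : {set 'I_m}) (j : 'I_m), j \in J -> (k <= j)%N -> f J = 0.

Let d_set0 f : koszul_d f set0 = \sum_i x i * f [set i].
Proof.
rewrite ffunE; apply: eq_big => i; first by rewrite inE.
move=> _; rewrite setU0 /koszul_sign; set B := [set j in _ | _].
have -> : B = set0 by apply/setP=> k; rewrite !inE.
by rewrite cards0 expr0 mul1r.
Qed.

Let cycle_supported k (f : {ffun {set 'I_m} -> A}) : regular_sequence ->
  (k <= m)%N -> supported k f -> koszul_d f = 0 ->
  (exists a, f set0 = \sum_(i < m | (i < k)%N) x i * a i) ->
  exists2 g, supported k g & f = koszul_d g.
Proof.
move=> x_regular; elim: k f => [|k IH] f km sf df [a fa].
  exists 0 => [J j _ _|]; first by rewrite ffunE.
  apply/ffunP=> J; rewrite !ffunE big1 => [|i _]; last by rewrite ffunE mulr0.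
  have [->|/set0Pn[j jJ]] := eqVneq J set0; last exact: sf jJ _.
  by rewrite fa big_pred0.
pose K := Ordinal km.
pose f2 : {ffun {set 'I_m} -> A} :=
  [ffun J : {set 'I_m} => if K \in J then 0 else f (K |: J)].
have sf2 : supported k f2.
  move=> J j jJ kj; rewrite ffunE; case: ifPn => // KJ.
  apply: (sf _ j); first by rewrite !inE jJ orbT.
  rewrite ltn_neqAle kj andbT; apply: contraNneq KJ => kj'.
  by have -> : K = j by exact: val_inj.
have df2 (J : {set 'I_m}) : K \notin J -> koszul_d f2 J = koszul_d f (K |: J).
  move=> KJ; rewrite !ffunE (bigD1 K) //= ffunE setU11 mulr0 add0r.
  apply: eq_big => [i|i /andP[iJ iK]]; first by rewrite !inE negb_or andbC.
  rewrite ffunE !inE eq_sym (negPf iK) (negPf KJ) /= setUCA.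
  have [Ki|iltK|/val_inj iK'] := ltngtP K i; last by rewrite iK' eqxx in iK.
    by rewrite (sf _ i) ?mulr0 ?setU11.
  by rewrite koszul_sign_gt.
have [g0 sg0 f2E0] : exists2 g, supported k g & f2 = koszul_d g.
  apply: IH => //; first exact: ltnW.
    apply/ffunP=> J; have [KJ|KJ] := boolP (K \in J); last first.
      by rewrite df2 // df !ffunE.
    rewrite !ffunE big1 // => i _.
    by rewrite (sf2 _ K) ?mulr0 // setU1r.
  rewrite ffunE inE setU0.
  have /(congr1 (fun h : {ffun {set 'I_m} -> A} => h set0)) := df.
  rewrite d_set0 ffunE (bigID (fun i : 'I_m => (i < k)%N)) /=.
  rewrite [X in _ + X](bigD1 K) /= ?ltnn // [X in _ + (_ + X)]big1; last first.
    move=> i /andP[ki iK]; rewrite (sf _ i) ?mulr0 ?inE //.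
    rewrite ltn_neqAle leqNgt ki andbT.
    by apply: contraNneq iK => kiE; apply/eqP/val_inj.
  rewrite addr0 addrC => /eqP; rewrite addr_eq0 => /eqP xKE.
  apply: (x_regular K (fun i => - f [set i])).
  by rewrite xKE -sumrN; apply: eq_bigr => i _; rewrite mulrN.
pose g : {ffun {set 'I_m} -> A} :=
  [ffun J : {set 'I_m} => if J == set0 then a K else g0 J].
have sg : supported k g.
  move=> J j jJ kj; rewrite ffunE; case: eqP => [J0|_]; last exact: sg0 jJ kj.
  by rewrite J0 inE in jJ.
have f2E : f2 = koszul_d g.
  rewrite f2E0; apply/ffunP=> J; rewrite !ffunE; apply: eq_bigr => i _.
  rewrite ffunE; case: eqP => // /setP/(_ i).
  by rewrite setU11 inE.
pose G : {ffun {set 'I_m} -> A} :=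
  [ffun J : {set 'I_m} => if K \in J then g (J :\ K) else 0].
have sG : supported k.+1 G.
  move=> J j jJ kj; rewrite ffunE; case: ifPn => // KJ.
  apply: (sg _ j); last exact: ltnW.
  rewrite !inE jJ andbT; apply: contraTneq kj => ->.
  by rewrite /= ltnn.
have dG (J : {set 'I_m}) : K \in J -> koszul_d G J = f J.
  move=> KJ; transitivity (f2 (J :\ K)); last first.
    by rewrite ffunE !inE eqxx /= setD1K.
  rewrite f2E !ffunE [RHS](bigD1 K) ?inE ?eqxx //=.
  rewrite (sg (K |: _) K) ?setU11 // mulr0 add0r.
  apply: eq_big => [i|i iJ].
    by rewrite !inE; case: eqVneq => [->|]; rewrite ?KJ //= andbT.
  have iK : i != K by apply: contraNneq iJ => ->.
  rewrite ffunE inE KJ orbT.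
  have -> : (i |: J) :\ K = i |: (J :\ K).
    by apply/setP=> j; rewrite !inE; case: eqVneq => [->|//]; rewrite eq_sym (negPf iK).
  have [Ki|iltK|/val_inj iK'] := ltngtP K i; last by rewrite iK' eqxx in iK.
    by rewrite (sg _ i) ?mulr0 ?setU11 // ltnW.
  by rewrite -{1}(setD1K KJ) koszul_sign_gt.
pose h := f - koszul_d G.
have sdG : supported k.+1 (koszul_d G).
  move=> J j jJ kj; rewrite ffunE big1 // => i _.
  by rewrite (sG _ j) ?mulr0 // setU1r.
have [g' sg' hE] : exists2 g', supported k g' & h = koszul_d g'.
  apply: IH; first exact: ltnW.
  - move=> J j jJ; rewrite leq_eqVlt => /predU1P[kj|kj]; last first.
      by rewrite ffunE [X in _ + X]ffunE (sf _ j) // (sdG _ j) // subrr.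
    have jK : K = j by exact: val_inj.
    have : K \in J by rewrite jK.
    by move=> /dG E; rewrite /h ffunE [X in _ + X]ffunE E subrr.
  - by rewrite /h koszul_dB df koszul_dd subr0.
  - exists (fun i => a i - G [set i]).
    rewrite /h ffunE [X in _ + X]ffunE fa d_set0.
    rewrite [X in _ - X](bigID (fun i : 'I_m => (i < k.+1)%N)) /=.
    rewrite [X in _ - (_ + X)]big1 => [|i]; last first.
      by rewrite -leqNgt => ki; rewrite (sG _ i) ?mulr0 ?inE.
    rewrite addr0 -sumrB (bigD1 K) //= -mulrBr.
    have -> : G [set K] = a K by rewrite !ffunE inE eqxx setDv eqxx.
    rewrite subrr mulr0 add0r.
    apply: eq_big => [i|i _]; last by rewrite mulrBr.
    by rewrite -val_eqE /= ltnS ltn_neqAle andbC.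
exists (G + g'); last by rewrite koszul_dD -hE /h addrC subrK.
move=> J j jJ kj; rewrite ffunE (sG _ j) // (sg' _ j) ?addr0 //.
exact: ltnW.
Qed.

Lemma koszul_regular_acyclic (f : {ffun {set 'I_m} -> A}) :
  regular_sequence ->
  koszul_d f = 0 -> (exists a, f set0 = \sum_i x i * a i) ->
  exists g, f = koszul_d g.
Proof.
move=> xreg df [a fa].
have [||g _ fg] := cycle_supported xreg (leqnn m) _ df; last by exists g.
- by move=> J j _; rewrite leqNgt ltn_ord.
- by exists a; rewrite fa; apply: eq_bigl => i; rewrite ltn_ord.
Qed.

End Koszul.

Section KoszulPolynomial.

Variables (F : fieldType) (m : nat).
Local Notation S := {mpoly F[m]}.

Let t (k : nat) : m.-tuple S := [tuple (if (i < k)%N then 0 else 'X_i) | i < m].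

Let mod_variables (k : nat) (p : S) :
  exists a, p - (p \mPo t k) = \sum_(i < m | (i < k)%N) ('X_i : S) * a i.
Proof.
pose I p := exists a, p = \sum_(i < m | (i < k)%N) ('X_i : S) * a i.
have ID p1 p2 : I p1 -> I p2 -> I (p1 + p2).
  move=> [c ->] [d ->]; exists (fun i => c i + d i).
  by rewrite -big_split; apply: eq_bigr => i _; rewrite mulrDr.
have IM p1 p2 : I p1 -> I (p1 * p2).
  move=> [c ->]; exists (fun i => c i * p2).
  by rewrite mulr_suml; apply: eq_bigr => i _; rewrite mulrA.
have I0 : I 0 by exists (fun=> 0); rewrite big1 // => i _; rewrite mulr0.
pose P p := I (p - (p \mPo t k)).
have PC c : P c%:MP by rewrite /P comp_mpolyC subrr.
have PX i : P 'X_i.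
  rewrite /P comp_mpolyXU -tnth_nth tnth_mktuple.
  case: ifPn => ik; last by rewrite subrr.
  exists (fun j => (i == j)%:R); rewrite subr0 (bigD1 i) //= eqxx mulr1.
  rewrite big1 ?addr0 // => j /andP[_ /negPf ij].
  by rewrite eq_sym ij mulr0.
have PM p1 p2 : P p1 -> P p2 -> P (p1 * p2).
  move=> P1 P2; rewrite /P rmorphM.
  have -> : p1 * p2 - (p1 \mPo t k) * (p2 \mPo t k) =
      (p1 - (p1 \mPo t k)) * p2 + (p2 - (p2 \mPo t k)) * (p1 \mPo t k).
    by rewrite !mulrBl [p2 * _]mulrC [(p2 \mPo _) * _]mulrC addrA subrK.
  by apply: ID; apply: IM.
have PD p1 p2 : P p1 -> P p2 -> P (p1 + p2).
  by move=> P1 P2; rewrite /P rmorphD opprD addrACA; apply: ID.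
rewrite -/(P p) (mpolyE p); apply: (big_ind P) => //; first by rewrite -mpolyC0.
move=> u _; rewrite -mul_mpolyC; apply: (PM) => //.
rewrite mpolyXE_id; apply: (big_ind P _ PM) => [|i _]; first by rewrite -mpolyC1.
by elim: (u i) => [|n IHn]; rewrite ?expr0 -?mpolyC1 // exprS; apply: (PM).
Qed.

Let variables_regular : regular_sequence (fun i : 'I_m => 'X_i : S).
Proof.
move=> k a b /(congr1 (comp_mpoly (t k))).
rewrite rmorphM rmorph_sum big1 => [|i ik]; last first.
  by rewrite rmorphM /= comp_mpolyXU -tnth_nth tnth_mktuple ik mul0r.
rewrite /= comp_mpolyXU -tnth_nth tnth_mktuple ltnn => /eqP.
rewrite mulf_eq0 -msize_poly_eq0 msizeX /= => /eqP b0.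
by have := mod_variables k b; rewrite b0 subr0.
Qed.

(* With [koszul_dd]: over S and for the variables, the Koszul complex,
   augmented by f |-> (f set0).@[0], is a free resolution of F = S/('X_i). *)
Lemma koszul_acyclic (f : {ffun {set 'I_m} -> S}) :
  koszul_d (fun i => 'X_i) f = 0 -> (f set0).@[fun=> 0] = 0 ->
  exists g, f = koszul_d (fun i => 'X_i) g.
Proof.
move=> df f0; apply: (koszul_regular_acyclic variables_regular) => //.
have [a fa] := mod_variables m (f set0); exists a.
transitivity (f set0 - (f set0 \mPo t m)); last first.
  by rewrite fa; apply: eq_bigl => i; rewrite ltn_ord.
suff -> : f set0 \mPo t m = ((f set0).@[fun=> 0])%:MP.
  by rewrite f0 mpolyC0 subr0.
rewrite comp_mpolyE mevalE raddf_sum; apply: eq_bigr => u _ /=.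
rewrite -mul_mpolyC rmorphM rmorph_prod; congr (_ * _).
apply: eq_bigr => i _.
by rewrite tnth_mktuple ltn_ord rmorphXn /= mpolyC0.
Qed.

End KoszulPolynomial.

(* For subspaces B of Z of V: Z / B has dimension n. *)
Definition is_quotient_dim (F : fieldType) (V : lmodType F) (Z B : V -> Prop)
    (n : nat) : Prop :=
  exists b : 'I_n -> V,
    (forall i, Z (b i)) /\
    (forall z, Z z -> exists! c : 'rV[F]_n, B (z - \sum_(i < n) c 0 i *: b i)).

Section TotalBetti.

Variables (F : fieldType) (m : nat) (K : simplicial_complex m).

(* The differential of the Koszul resolution of F tensored with F[K]; the
   homology of this complex is the sum of the Tor_i(F[K], F) over all i. *)
Definition tor_d : {ffun {set 'I_m} -> SR_ring F K} ->
    {ffun {set 'I_m} -> SR_ring F K} :=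
  koszul_d (fun i : 'I_m => SR_pi K 'X_i).

(* Tor is finite-dimensional, F[K] being a finitely generated module. *)
Definition total_betti : nat :=
  epsilon (inhabits 0%N)
    (is_quotient_dim (fun f => tor_d f = 0) (fun f => exists g, f = tor_d g)).

End TotalBetti.

Definition in_Sigma (m : nat) (d : int) (K : simplicial_complex m) : Prop :=
  cdim K = d.

Definition D_minimal (F : fieldType) (m : nat) (d : int)
    (K : simplicial_complex m) : Prop :=
  in_Sigma d K /\
  forall L : simplicial_complex m, in_Sigma d L ->
    (total_betti F K <= total_betti F L)%N.

(* The exponent is nonnegative, since cdim K <= m - 1. *)
Definition taut (F : fieldType) (m : nat) (K : simplicial_complex m) : Prop :=
  total_betti F K = (2 ^ absz (m%:Z - cdim K - 1)%R)%N.

(* Main.v *)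
Require Import Defs.
From HB Require Import structures.
From mathcomp Require Import all_boot all_order all_algebra.
From mathcomp Require Import ring_quotient mpoly zify.
From Stdlib Require Import Classical ClassicalEpsilon.

(* Only the squarefree multidegrees of the Koszul complex of F[K] carry homology,
   and there the complex has the finite basis v^T e_I, with T a face of K disjoint from I.
   Lower bound: let s be a largest face.  For each subset A of the complement of s,
   the part of this complex where the union of I and T has trace A outside s has odd
   dimension (for T other than s, toggle in I an element of s not in T), so it is not
   exact; this gives 2^(m - #|s|) independent classes.
   When 2k <= m, the bound is attained by the join of k copies of the 0-sphere
   {w, m-1-w}, w < k, with a simplex: contracting along one vertex after the other
   leaves only the 2^k basis elements v^(rev I) e_I with I included in {0, .., k-1}.
   As d >= [(m-1)/2] means 2(m-d-1) <= m, the minimum over Sigma(m,d) is 2^(m-d-1). *)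

Set Implicit Arguments.
Unset Strict Implicit.
Unset Printing Implicit Defensive.

Import GRing.Theory.

Local Open Scope ring_scope.

(** * Linear independence and dimension modulo a subspace *)

Section IndependenceModulo.

Variables (F : fieldType) (V : lmodType F) (Z B : V -> Prop).
Hypothesis B_lin : forall c u v, B u -> B v -> B (c *: u + v).
Hypothesis B0 : B 0.

Definition free_mod r (z : 'I_r -> V) : Prop :=
  forall c : 'I_r -> F, B (\sum_i c i *: z i) -> forall i, c i = 0.

Definition spans_mod N (w : 'I_N -> V) : Prop :=
  forall z, Z z -> exists c : 'I_N -> F, B (z - \sum_i c i *: w i).

Lemma mod_sum I (s : seq I) (P : pred I) (u : I -> V) :
  (forall i, P i -> B (u i)) -> B (\sum_(i <- s | P i) u i).
Proof.
move=> Bu; apply: (big_ind B) => // x y Bx By.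
by rewrite -[x]scale1r; apply: B_lin.
Qed.

Lemma modZ c u : B u -> B (c *: u).
Proof. by move=> Bu; rewrite -[_ *: _]addr0; apply: B_lin. Qed.

(** Expanding the [z i] in the [w j] modulo [B] gives an [r] by [N] matrix; for [N < r] a nonzero
    vector of its left kernel would be a relation among the [z i] modulo [B]. *)
Lemma free_mod_leq r (z : 'I_r -> V) N (w : 'I_N -> V) :
  (forall i, Z (z i)) -> free_mod z -> spans_mod w -> (r <= N)%N.
Proof.
move=> Zz zfree wspan.
have /fin_all_exists[M Mz] i : exists c : 'I_N -> F,
    B (z i - \sum_j c j *: w j) by apply: wspan.
rewrite leqNgt; apply/negP=> Nr.
pose A : 'M[F]_(r, N) := \matrix_(i, j) M i j.
have : kermx A != 0.
  by rewrite kermx_eq0 /row_free neq_ltn (leq_ltn_trans (rank_leq_col A)).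
case/rowV0Pn=> v /sub_kermxP vA /negP[]; apply/eqP/rowP=> i; rewrite mxE.
apply: (zfree (fun i => v 0 i)).
have -> : \sum_i v 0 i *: z i = \sum_i v 0 i *: (z i - \sum_j M i j *: w j).
  under [RHS]eq_bigr do rewrite scalerBr.
  rewrite sumrB [X in _ - X](_ : _ = 0) ?subr0 //.
  under eq_bigr do rewrite scaler_sumr.
  rewrite exchange_big big1 //= => j _.
  under eq_bigr do rewrite scalerA.
  rewrite -scaler_suml.
  have /rowP/(_ j) := vA; rewrite !mxE => vAj.
  by rewrite (_ : \sum_i _ = 0) ?scale0r // -[RHS]vAj; apply: eq_bigr => i' _; rewrite mxE.
by apply: mod_sum => j _; apply: modZ.
Qed.

(** Freeness is the uniqueness of coordinates in [is_quotient_dim], applied to the zero vector. *)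
Lemma quotient_dim_free n : Z 0 ->
  is_quotient_dim Z B n -> exists2 b : 'I_n -> V, forall i, Z (b i) & free_mod b /\ spans_mod b.
Proof.
move=> Z0 [b [Zb bP]]; exists b => //; split=> [c Bc i|z /bP[c [Bc _]]]; last by exists (c 0).
have [d [_ d_uniq]] := bP 0 Z0.
have d0 : d = 0.
  apply: d_uniq; rewrite big1 ?subr0 // => j _.
  by rewrite mxE scale0r.
have /rowP/(_ i) : d = \row_j - c j.
  apply: d_uniq; rewrite sub0r -sumrN (eq_bigr (fun j => c j *: b j)) // => j _.
  by rewrite mxE scaleNr opprK.
by rewrite d0 !mxE => /esym/eqP; rewrite oppr_eq0 => /eqP.
Qed.

(** Otherwise every free family in [Z] could be enlarged by a vector outside its span, up to size
    [N + 1], against [free_mod_leq]. *)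
Lemma quotient_dim_exists N (w : 'I_N -> V) :
  spans_mod w -> exists n, is_quotient_dim Z B n.
Proof.
move=> wspan; apply: NNPP => nodim.
suff /(_ N.+1)[z Zz zfree] : forall r, exists2 z : 'I_r -> V,
    forall i, Z (z i) & free_mod z.
  by have := free_mod_leq Zz zfree wspan; rewrite ltnn.
elim=> [|r [z Zz zfree]]; first by exists (fun=> 0) => [[]|c _ []].
have [y Zy yspan] : exists2 y, Z y &
    forall c : 'I_r -> F, ~ B (y - \sum_i c i *: z i).
  apply: NNPP => noy; apply: nodim; exists r, z; split=> // y Zy.
  have [c Bc] : exists c : 'I_r -> F, B (y - \sum_i c i *: z i).
    by apply: NNPP => noc; apply: noy; exists y => // c Bc; apply: noc; exists c.
  exists (\row_i c i); split.
    by under eq_bigr do rewrite mxE.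
  move=> d Bd; apply/rowP=> i; rewrite mxE; apply/eqP; rewrite -subr_eq0; apply/eqP.
  apply: (zfree (fun i => c i - d 0 i)).
  have -> : \sum_j (c j - d 0 j) *: z j =
      (-1) *: (y - \sum_j c j *: z j) + (y - \sum_j d 0 j *: z j).
    under eq_bigr do rewrite scalerBl.
    by rewrite sumrB scaleN1r opprB addrA subrK.
  exact: B_lin.
exists (fun i => oapp z y (unlift ord0 i)) => [i|c].
  by case: unliftP => [j|] _ /=.
rewrite big_ord_recl unlift_none /=.
under eq_bigr do rewrite liftK /=.
have [c0|c0] := eqVneq (c ord0) 0.
  rewrite c0 scale0r add0r => /zfree c'0 i.
  by case: (unliftP ord0 i) => [j|] ->.
(* A nonzero coefficient of [y] could be inverted, putting [y] in the span of [z] modulo [B]. *)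
move=> Bc; case: (yspan (fun i => - (c ord0)^-1 * c (lift ord0 i))).
have := modZ (c ord0)^-1 Bc.
rewrite scalerDr scalerA mulVf // scale1r scaler_sumr.
congr (B (_ + _)); rewrite -sumrN; apply: eq_bigr => i _.
by rewrite scalerA mulNr scaleNr opprK.
Qed.

End IndependenceModulo.

(** * Monomial coordinates on the Stanley-Reisner ring *)

Section Coefficients.

Variables (F : fieldType) (m : nat) (K : simplicial_complex m).

Definition mnm_supp (u : 'X_{1..m}) : {set 'I_m} := [set i | (0 < u i)%N].

Lemma SR_pi_eq0 (p : {mpoly F[m]}) :
  (SR_pi K p == 0) = (p \in SR_ideal (F:=F) K).
Proof.
have := Quotient.idealrBE (SR_ideal (F:=F) K) p 0; rewrite subr0 => ->.
by rewrite -[0 in LHS](rmorph0 (SR_pi (F := F) K)).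
Qed.

Lemma mcoeffMXE (p : {mpoly F[m]}) (v u : 'X_{1..m}) :
  (p * 'X_[v])@_u = if (v <= u)%MM then p@_(u - v) else 0.
Proof.
case: ifPn => [vu|vu]; first by rewrite -{1}(submK vu) addmC mcoeffMX.
apply/eqP; rewrite mcoeff_eq0 (perm_mem (msuppMX _ _)).
by apply: contra vu => /mapP[w _ ->]; apply: lem_addr.
Qed.


Lemma prod_setX (J : {set 'I_m}) :
  \prod_(i in J) 'X_i = 'X_[mesym1 J] :> {mpoly F[m]}.
Proof.
rewrite mprodXE; congr 'X_[_]; apply/mnmP=> i; rewrite mnm_sumE mnmE big_mkcond.
rewrite (bigD1 i) //= big1 => [|j ji]; last by rewrite mnm1E (negPf ji) if_same.
by rewrite mnm1E eqxx addn0; case: (i \in J).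
Qed.

(** The ideal is generated by monomials, so membership is decided one coefficient at a time: a
    monomial lies in it exactly when its support is a nonface. *)
Lemma SR_idealE (p : {mpoly F[m]}) :
  p \in SR_ideal (F:=F) K <-> forall u, mnm_supp u \in faces K -> p@_u = 0.
Proof.
split=> [/SR_idealP[g ->] u uK|p0].
  rewrite raddf_sum big1 //= => J JK.
  rewrite prod_setX mcoeffMXE; case: ifPn => // /mnm_lepP Ju.
  case/negP: JK; apply: face_sub uK; apply/subsetP=> i iJ.
  by rewrite inE; apply: leq_trans (Ju i); rewrite mnmE iJ.
apply/SR_idealP.
(* The terms of [p] are grouped by support; those with support [J] are divisible by the generator of
   [J]. *)
exists (fun J => \sum_(u <- msupp p | mnm_supp u == J) p@_u *: 'X_[u - mesym1 J]).
under eq_bigr do rewrite mulr_suml.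
rewrite (exchange_big_dep predT) //= {1}(mpolyE p) big_seq [RHS]big_seq.
apply: eq_bigr => u; rewrite mcoeff_msupp => pu.
rewrite (big_pred1 (mnm_supp u)) => [|J]; last first.
  rewrite [RHS]eq_sym; case: (eqVneq (mnm_supp u) J) => [<-|]; rewrite ?andbF //.
  by rewrite andbT; apply: contraNN pu => /p0 ->.
rewrite prod_setX -scalerAl -mpolyXD submK //.
by apply/mnm_lepP=> i; rewrite mnmE inE; case: (u i).
Qed.

Definition SR_lift (a : SR_ring F K) : {mpoly F[m]} :=
  repr (a : {ideal_quot SR_ideal (F:=F) K}).

Lemma SR_liftK a : SR_pi K (SR_lift a) = a.
Proof. exact: reprK. Qed.

(** A coordinate for the basis of [F[K]] formed by the monomials supported on faces; by [SR_idealE]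
    it does not depend on the representative [SR_lift a]. *)
Definition SR_coef (u : 'X_{1..m}) (a : SR_ring F K) : F :=
  if mnm_supp u \in faces K then (SR_lift a)@_u else 0.

Lemma SR_coef_pi p u :
  SR_coef u (SR_pi K p) = if mnm_supp u \in faces K then p@_u else 0.
Proof.
rewrite /SR_coef; case: ifP => // uK; apply/eqP; rewrite -subr_eq0 -mcoeffB.
have /SR_idealE -> // : SR_lift (SR_pi K p) - p \in SR_ideal (F:=F) K.
by rewrite -SR_pi_eq0 rmorphB /= SR_liftK subrr.
Qed.

Lemma SR_coef_inj a b : (forall u, SR_coef u a = SR_coef u b) -> a = b.
Proof.
move=> ab; rewrite -[a]SR_liftK -[b]SR_liftK; apply/eqP.
rewrite -subr_eq0 -rmorphB SR_pi_eq0; apply/SR_idealE=> u uK.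
by have := ab u; rewrite /SR_coef uK mcoeffB => ->; rewrite subrr.
Qed.

Lemma SR_coef_is_additive u : zmod_morphism (SR_coef u).
Proof.
move=> a b; rewrite -[a]SR_liftK -[b]SR_liftK -rmorphB !SR_coef_pi.
by case: ifP; rewrite ?mcoeffB ?subr0.
Qed.

HB.instance Definition _ u := GRing.isZmodMorphism.Build _ _ (SR_coef u)
  (SR_coef_is_additive u).

Lemma SR_coefZ c a u : SR_coef u (c *: a) = c * SR_coef u a.
Proof.
have -> : c *: a = SR_pi K (c%:MP * SR_lift a) by rewrite rmorphM /= SR_liftK.
by rewrite SR_coef_pi mcoeffCM -{2}[a]SR_liftK SR_coef_pi; case: ifP; rewrite ?mulr0.
Qed.

Lemma SR_coef_out a u : mnm_supp u \notin faces K -> SR_coef u a = 0.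
Proof. by rewrite /SR_coef => /negPf ->. Qed.

Lemma SR_coefX i a u : mnm_supp u \in faces K ->
  SR_coef u (SR_pi K 'X_i * a) = if (0 < u i)%N then SR_coef (u - U_(i)) a else 0.
Proof.
move=> uK; rewrite -{1}[a]SR_liftK -rmorphM SR_coef_pi uK mulrC mcoeffMXE lep1mP.
rewrite -lt0n; case: ifP => // _; rewrite /SR_coef ifT //.
apply: face_sub uK; apply/subsetP=> j; rewrite !inE mnmBE => /leq_trans.
by apply; apply: leq_subr.
Qed.

(** [undup] matters because [s] may repeat an exponent, as happens when the truncated subtraction of
    [U_(w)] is mapped over a support. *)
Definition SR_make (s : seq 'X_{1..m}) (c : 'X_{1..m} -> F) : SR_ring F K :=
  SR_pi K (\sum_(u <- undup s) c u *: 'X_[u]).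

Lemma SR_coef_make s c u : SR_coef u (SR_make s c) =
  if (mnm_supp u \in faces K) && (u \in s) then c u else 0.
Proof.
rewrite SR_coef_pi; case: ifP => //= uK.
rewrite raddf_sum /=.
under eq_bigr do rewrite mcoeffZ mcoeffX.
case: ifPn => us; last first.
  rewrite big_seq big1 // => v; rewrite mem_undup => vs.
  by case: eqP vs us => [->->//|]; rewrite mulr0.
rewrite (bigD1_seq u) ?undup_uniq ?mem_undup //= eqxx mulr1 big1 ?addr0 //.
by move=> v /negPf->; rewrite mulr0.
Qed.

End Coefficients.

(** * Signs in the exterior algebra *)

Lemma koszul_sign_sqr m (A : comNzRingType) (J : {set 'I_m}) i :
  koszul_sign A J i * koszul_sign A J i = 1.
Proof. by rewrite /koszul_sign -expr2 sqrr_sign. Qed.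

(** This is the anticommutation of e_i and e_w: only the sign of the larger of the two indices is
    affected by the presence of the other. *)
Lemma koszul_sign_swap m (A : comNzRingType) (I : {set 'I_m}) (i w : 'I_m) :
  w \in I -> i \notin I ->
  koszul_sign A I i * koszul_sign A (i |: I :\ w) w =
  - (koszul_sign A (I :\ w) i * koszul_sign A (I :\ w) w).
Proof.
move=> wI iI; set J := I :\ w.
have wJ : w \notin J by rewrite !inE eqxx.
have iJ : i \notin J by rewrite !inE (negPf iI) andbF.
have wi : w != i by apply: contraNneq iI => <-.
have -> : I = w |: J by rewrite setD1K.
case: (ltngtP w i) => [lt_wi|lt_iw|/val_inj/eqP]; last by rewrite (negPf wi).
  by rewrite koszul_sign_lt // koszul_sign_gt // mulNr.
by rewrite koszul_sign_gt // koszul_sign_lt // mulrN.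
Qed.

Lemma ffunBE (T : finType) (V : zmodType) (f g : {ffun T -> V}) x :
  (f - g) x = f x - g x.
Proof. by rewrite !ffunE. Qed.

(** * Reduction of the Koszul complex to squarefree multidegrees *)

Section SquarefreePart.

Variables (F : fieldType) (m : nat) (K : simplicial_complex m).
Local Notation sgn := (@koszul_sign m F).
Local Notation C := {ffun {set 'I_m} -> SR_ring F K}.
Local Notation D := {ffun {set 'I_m} * {set 'I_m} -> F^o}.
Local Notation tor_d := (@tor_d F m K).

Lemma SR_coef_sign J i u a :
  SR_coef u (koszul_sign (SR_ring F K) J i * a) = sgn J i * SR_coef u a.
Proof.
rewrite /koszul_sign -signr_odd -[in RHS]signr_odd.
by case: odd; rewrite ?expr0 ?expr1 ?mul1r // !mulN1r raddfN.
Qed.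

Lemma SR_coef_tor_d (z : C) I u : mnm_supp u \in faces K ->
  SR_coef u (tor_d z I) = \sum_(i | (i \notin I) && (0 < u i)%N)
    sgn I i * SR_coef (u - U_(i)) (z (i |: I)).
Proof.
move=> uK; rewrite ffunE raddf_sum big_mkcondr; apply: eq_bigr => i _ /=.
by rewrite -mulrA SR_coef_sign SR_coefX //; case: ifP; rewrite ?mulr0.
Qed.

Lemma tor_dD : {morph tor_d : f g / f + g}.
Proof. exact: koszul_dD. Qed.

Lemma tor_dB : {morph tor_d : f g / f - g}.
Proof. exact: koszul_dB. Qed.

Lemma tor_d0 : tor_d 0 = 0.
Proof. by have := tor_dB 0 0; rewrite !subrr. Qed.

Lemma tor_dd f : tor_d (tor_d f) = 0.
Proof. exact: koszul_dd. Qed.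

Lemma tor_dZ c f : tor_d (c *: f) = c *: tor_d f.
Proof.
apply/ffunP=> J; rewrite !ffunE scaler_sumr; apply: eq_bigr => i _.
by rewrite ffunE scalerAr.
Qed.

(** [u w + (w \in I)] is the [w]-th component of the multidegree of the monomial of [u] times
    e_I. *)
Definition sqfree (I : {set 'I_m}) (u : 'X_{1..m}) :=
  [forall w, u w + (w \in I) <= 1]%N.

(* The contracting homotopy divides by the w-th variable and multiplies by e_w. *)
Lemma tor_step (w : 'I_m) (z : C) : tor_d z = 0 ->
  exists g, forall I u, mnm_supp u \in faces K ->
    SR_coef u ((z - tor_d g) I) =
      if (u w + (w \in I) <= 1)%N then SR_coef u (z I) else 0.
Proof.
move=> dz.
(* The guard [0 < u w] restricts the division to monomials divisible by the square of the [w]-th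
   variable, so that the support, and with it the face condition, is unchanged. *)
pose g : C := [ffun I : {set 'I_m} => if w \in I then koszul_sign _ (I :\ w) w *
  SR_make K [seq (u - U_(w))%MM | u <- msupp (SR_lift (z (I :\ w)))]
    (fun u => if (0 < u w)%N then SR_coef (u + U_(w)) (z (I :\ w)) else 0)
  else 0].
have gE I u : SR_coef u (g I) = if (w \in I) && (0 < u w)%N
    then sgn (I :\ w) w * SR_coef (u + U_(w)) (z (I :\ w)) else 0.
  rewrite ffunE; case: ifP => wI /=; last by rewrite raddf0.
  rewrite SR_coef_sign SR_coef_make.
  case: ifPn => [/andP[uK _]|]; first by case: ifP; rewrite ?mulr0.
  rewrite mulr0; case: ifP => // uw.
  have -> : mnm_supp u = mnm_supp (u + U_(w)).
    apply/setP=> j; rewrite !inE mnmDE mnm1E.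
    by case: eqP => [<-|_]; rewrite ?uw ?addn0 // addn1.
  rewrite negb_and => /orP[/SR_coef_out->|]; first by rewrite mulr0.
  move=> us; rewrite /SR_coef; case: ifP => _; last by rewrite mulr0.
  rewrite (_ : _@__ = 0) ?mulr0 //; apply/eqP; rewrite mcoeff_eq0.
  by apply: contra us => us; apply/mapP; exists (u + U_(w))%MM; rewrite ?addmK.
exists g => I u uK.
rewrite ffunBE raddfB /= SR_coef_tor_d //.
under eq_bigr do rewrite gE.
have [wI|wI] := boolP (w \in I); last first.
  rewrite addn0 [X in _ - X](_ : _ = if (1 < u w)%N then SR_coef u (z I) else 0).
    by case: ltngtP; rewrite ?subr0 ?subrr.
  have [uw0|uw] := posnP (u w).
    rewrite uw0 big1 // => i /andP[iI ui].
    rewrite !inE (negPf wI) orbF; case: eqP => [wi|_] /=; rewrite ?mulr0 //.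
    by move: ui; rewrite -wi uw0.
  rewrite (bigD1 w) ?wI ?uw //= !inE eqxx /=.
  rewrite big1 => [|i /andP[_ iw]]; last first.
    by rewrite !inE eq_sym (negPf iw) (negPf wI) mulr0.
  rewrite addr0 mnmBE mnm1E eqxx subn_gt0 setU1K // submK ?lep1mP -?lt0n //.
  by case: ifP => _; rewrite ?mulr0 // mulrA koszul_sign_sqr mul1r.
rewrite addn1 ltnS leqn0.
have [uw0|uw] := posnP (u w).
  rewrite big1 ?subr0 // => i _.
  by rewrite mnmBE uw0 /= andbF mulr0.
apply/eqP; rewrite subr_eq0; apply/eqP.
(* The cycle equation at [I :\ w], one power of the [w]-th variable higher, expresses the
   coefficient of [z I] at [u] through the terms of [tor_d g]. *)
have : SR_coef (u + U_(w)) (tor_d z (I :\ w)) = 0.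
  by rewrite dz ffunE raddf0.
have suppE : mnm_supp (u + U_(w)) = mnm_supp u.
  apply/setP=> j; rewrite !inE mnmDE mnm1E.
  by case: eqP => [<-|_]; rewrite ?uw ?addn0 // addn1.
rewrite SR_coef_tor_d ?suppE // (bigD1 w) /=; last first.
  by rewrite !inE eqxx mnmDE ltn_addr.
rewrite setD1K // addmK => /(canRL (addrK _)).
rewrite sub0r -sumrN => /(congr1 (fun x => sgn (I :\ w) w * x)).
rewrite mulrA koszul_sign_sqr mul1r mulr_sumr => ->.
apply: eq_big => [i|i]; rewrite !inE ?mnmDE ?mnm1E [w == i]eq_sym.
  have [->|iw] := eqVneq i w; first by rewrite wI andbF.
  by rewrite addn0 andbT.
have [->|iw] := eqVneq i w; first by rewrite andbF.
rewrite addn0 andbT => /andP[iI ui].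
have iIw : (i |: I) :\ w = i |: I :\ w.
  by apply/setP=> j; rewrite !inE; case: (eqVneq j i) => [->|//]; rewrite iw.
rewrite wI mnmBE mnm1E (negPf iw) subn0 uw iIw mulrN mulrA mulrA.
rewrite koszul_sign_swap // mulNr [_ * koszul_sign _ _ i]mulrC.
rewrite (_ : u + U_(w) - U_(i) = u - U_(i) + U_(w))%MM //.
apply/mnmP=> j; rewrite !mnmE; case: eqVneq => [<-|_]; rewrite ?addn0 //.
by rewrite (negPf iw) !subn0.
Qed.

(** One [tor_step] is made for each vertex; it only kills coefficients, so what earlier steps
    achieved persists. *)
Lemma tor_reduce (z : C) : tor_d z = 0 ->
  exists g, forall I u, mnm_supp u \in faces K ->
    SR_coef u ((z - tor_d g) I) = if sqfree I u then SR_coef u (z I) else 0.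
Proof.
move=> dz; suff [g gP] : exists g, forall I u, mnm_supp u \in faces K ->
    SR_coef u ((z - tor_d g) I) =
    if all (fun w => u w + (w \in I) <= 1)%N (enum 'I_m) then SR_coef u (z I) else 0.
  exists g => I u uK; rewrite gP //; congr (if _ then _ else _).
  apply/allP/forallP=> [h w|h w _]; last exact: h.
  by apply: h; rewrite mem_enum.
elim: (enum 'I_m) => [|w s [g gP]] /=.
  by exists 0 => I u _; rewrite tor_d0 subr0.
have [g' g'P] : exists g', forall I u, mnm_supp u \in faces K ->
    SR_coef u ((z - tor_d g - tor_d g') I) =
    if (u w + (w \in I) <= 1)%N then SR_coef u ((z - tor_d g) I) else 0.
  by apply: tor_step; rewrite tor_dB tor_dd dz subr0.
exists (g + g') => I u uK; rewrite tor_dD opprD addrA g'P // gP //.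
by case: ifP.
Qed.

Definition valid (p : {set 'I_m} * {set 'I_m}) :=
  [disjoint p.1 & p.2] && (p.2 \in faces K).

Definition supported (f : D) := forall p, ~~ valid p -> f p = 0.

(* The coefficient of a chain at [(I, T)] is that of the monomial of T times e_I. *)
Definition sq_d (f : D) : D :=
  [ffun p => if valid p then
     \sum_(i in p.2) sgn p.1 i * f (i |: p.1, p.2 :\ i) else 0].

Definition sq_part (z : C) : D :=
  [ffun p => if valid p then SR_coef (mesym1 p.2) (z p.1) else 0].

Definition sq_incl (f : D) : C :=
  [ffun I : {set 'I_m} => @SR_make F m K [seq mesym1 T | T <- enum {set 'I_m}]
     (fun u => if [disjoint I & mnm_supp u] then f (I, mnm_supp u) else 0)].

Lemma mnm_supp_mesym1 (T : {set 'I_m}) : mnm_supp (mesym1 T) = T.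
Proof. by apply/setP=> i; rewrite inE mnmE; case: (i \in T). Qed.

Lemma sqfreeP (I : {set 'I_m}) (u : 'X_{1..m}) :
  reflect (u = mesym1 (mnm_supp u) /\ [disjoint I & mnm_supp u]) (sqfree I u).
Proof.
apply: (iffP forallP) => [uI|[uE dis] w].
  split; first by apply/mnmP=> w; rewrite mnmE inE; case: (u w) (uI w) => [|[]].
  rewrite -setI_eq0; apply/set0Pn=> -[w]; rewrite !inE => /andP[wI uw].
  by have := uI w; rewrite wI addn1 ltnS leqNgt uw.
rewrite uE mnmE; have [wI|_] := boolP (w \in I); first by rewrite (disjointFr dis wI).
by rewrite addn0 leq_b1.
Qed.

Lemma SR_coef_incl f I u : mnm_supp u \in faces K ->
  SR_coef u (sq_incl f I) = if sqfree I u then f (I, mnm_supp u) else 0.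
Proof.
move=> uK; rewrite ffunE SR_coef_make uK /=.
have [/sqfreeP[uE dis]|nsq] := boolP (sqfree I u).
  by rewrite dis {1}uE map_f // mem_enum.
case: ifP => // /mapP[T _ uE]; case: ifP => // dis.
by case/sqfreeP: nsq; rewrite uE mnm_supp_mesym1 -uE; split=> //; rewrite uE mnm_supp_mesym1 in dis.
Qed.

Lemma sq_part_linear c f g : sq_part (c *: f + g) = c *: sq_part f + sq_part g.
Proof.
apply/ffunP=> p; rewrite !ffunE; case: ifP => _; last by rewrite scaler0 addr0.
by rewrite raddfD /= SR_coefZ.
Qed.

Lemma sq_incl_linear c f g : sq_incl (c *: f + g) = c *: sq_incl f + sq_incl g.
Proof.
apply/ffunP=> I; apply: SR_coef_inj => u.
have [uK|uK] := boolP (mnm_supp u \in faces K); last by rewrite !SR_coef_out.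
have -> : (c *: sq_incl f + sq_incl g) I = c *: sq_incl f I + sq_incl g I.
  by rewrite ffunE [X in X + _]ffunE.
rewrite raddfD /= SR_coefZ !SR_coef_incl // !ffunE /=.
by case: ifP => _; rewrite ?mulr0 ?addr0.
Qed.

Lemma sq_inclK f : supported f -> sq_part (sq_incl f) = f.
Proof.
move=> sf; apply/ffunP=> -[I T]; rewrite ffunE; case: ifPn => [/andP[dis TK]|/sf //].
rewrite SR_coef_incl ?mnm_supp_mesym1 // ifT //.
by apply/sqfreeP; rewrite mnm_supp_mesym1.
Qed.

Lemma mesym1D1 (T : {set 'I_m}) i : i \in T -> (mesym1 T - U_(i) = mesym1 (T :\ i))%MM.
Proof.
move=> iT; apply/mnmP=> j; rewrite !mnmE !inE.
by have [->|_] := eqVneq j i; rewrite ?iT ?subn0.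
Qed.

Lemma valid_move (I T : {set 'I_m}) i : valid (I, T) -> i \in T -> valid (i |: I, T :\ i).
Proof.
case/andP=> /= dis TK iT; apply/andP; split=> /=; last first.
  by apply: face_sub TK; apply: subD1set.
rewrite -setI_eq0; apply/set0Pn=> -[j]; rewrite !inE => /and3P[+ ji jT].
by rewrite (negPf ji) /= => jI; rewrite (disjointFr dis jI) in jT.
Qed.

Lemma sq_part_d z : sq_part (tor_d z) = sq_d (sq_part z).
Proof.
apply/ffunP=> -[I T]; rewrite !ffunE /=; case: ifP => // IT.
have /andP[/= dis TK] := IT.
rewrite -[\sum_(i | _) _](_ : tor_d z I = _) ?SR_coef_tor_d ?mnm_supp_mesym1 ?ffunE //.
apply: eq_big => [i|i]; rewrite mnmE.
  case: (boolP (i \in T)) => iT; last by rewrite andbF.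
  by rewrite (disjointFl dis iT).
by case: (boolP (i \in T)) => iT; rewrite ?andbF // ffunE valid_move //= mesym1D1.
Qed.

Lemma sq_incl_d f : tor_d (sq_incl f) = sq_incl (sq_d f).
Proof.
apply/ffunP=> I; apply: SR_coef_inj => u.
have [uK|uK] := boolP (mnm_supp u \in faces K); last by rewrite !SR_coef_out.
rewrite SR_coef_tor_d // SR_coef_incl //.
have suppD i : (0 < u i)%N -> mnm_supp (u - U_(i)) \in faces K.
  move=> _; apply: face_sub uK; apply/subsetP=> j; rewrite !inE mnmBE => /leq_trans.
  by apply; apply: leq_subr.
have sqE i : i \notin I -> (0 < u i)%N -> sqfree (i |: I) (u - U_(i)) = sqfree I u.
  move=> iI ui; apply: eq_forallb => j; rewrite mnmBE mnm1E !inE.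
  case: eqVneq => [<-|ij]; last by rewrite subn0.
  by rewrite (negPf iI) addn0 subnK.
under eq_bigr => i /andP[iI ui] do rewrite SR_coef_incl ?suppD // sqE //.
case: ifP => [/sqfreeP[uE dis]|_]; last by rewrite big1 // => i _; rewrite mulr0.
rewrite ffunE /= /valid /= dis uK; apply: eq_big => [i|i /andP[iI ui]].
  rewrite inE; case: ltnP => ui; rewrite ?andbF // andbT.
  by rewrite (disjointFl dis) // inE.
by rewrite {1}uE mesym1D1 ?inE // mnm_supp_mesym1.
Qed.

(** [sq_incl] after [sq_part] keeps exactly the squarefree terms, which are what [tor_reduce]
    leaves. With [sq_inclK] and the two chain map properties, this identifies Koszul homology with
    that of [sq_d] on supported chains. *)
Lemma sq_homotopy z : tor_d z = 0 -> exists g, z - tor_d g = sq_incl (sq_part z).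
Proof.
case/tor_reduce=> g gP; exists g; apply/ffunP=> I; apply: SR_coef_inj => u.
have [uK|uK] := boolP (mnm_supp u \in faces K); last by rewrite !SR_coef_out.
rewrite gP // SR_coef_incl //; case: sqfreeP => // -[uE dis].
by rewrite ffunE /valid /= dis uK -uE.
Qed.

End SquarefreePart.

(** * The total Betti number in terms of squarefree chains *)

Section TotalBettiSquarefree.

Variables (F : fieldType) (m : nat) (K : simplicial_complex m).
Local Notation C := {ffun {set 'I_m} -> SR_ring F K}.
Local Notation D := {ffun {set 'I_m} * {set 'I_m} -> F^o}.
Local Notation tor_d := (@tor_d F m K).
Local Notation sq_d := (@sq_d F m K).

HB.instance Definition _ := GRing.isLinear.Build F D C _ (@sq_incl F m K) (@sq_incl_linear F m K).
HB.instance Definition _ := GRing.isLinear.Build F C D _ (@sq_part F m K) (@sq_part_linear F m K).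

Lemma sq_d_linear c f g : sq_d (c *: f + g) = c *: sq_d f + sq_d g.
Proof.
apply/ffunP=> p; rewrite !ffunE; case: ifP => _; last by rewrite scaler0 addr0.
rewrite scaler_sumr -big_split; apply: eq_bigr => i _ /=.
by rewrite !ffunE mulrDr; congr (_ + _); apply: mulrCA.
Qed.

HB.instance Definition _ := GRing.isLinear.Build F D D _ sq_d sq_d_linear.

Lemma sq_d_supported f : supported K (sq_d f).
Proof. by move=> p pK; rewrite ffunE (negPf pK). Qed.

Lemma sq_dd f : sq_d (sq_d f) = 0.
Proof.
rewrite -[LHS](@sq_inclK F m K); last exact: sq_d_supported.
by rewrite -!sq_incl_d tor_dd linear0.
Qed.

Let Z (f : C) := tor_d f = 0.
Let B (f : C) := exists g, f = tor_d g.

Let B_lin c u v : B u -> B v -> B (c *: u + v).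
Proof. by move=> [f ->] [g ->]; exists (c *: f + g); rewrite tor_dD tor_dZ. Qed.

Let B0 : B 0.
Proof. by exists 0; rewrite tor_d0. Qed.

Lemma incl_spans N (w : 'I_N -> D) :
  (forall z, supported K z -> sq_d z = 0 ->
    exists (c : 'I_N -> F) g, z - \sum_i c i *: w i = sq_d g) ->
  spans_mod Z B (fun i => sq_incl K (w i)).
Proof.
move=> wP z dz; have [g gP] := sq_homotopy dz.
have sz : supported K (sq_part z) by move=> p pK; rewrite ffunE (negPf pK).
have dz0 : sq_d (sq_part z) = 0 by rewrite -sq_part_d dz linear0.
have [c [g' g'P]] := wP _ sz dz0.
exists c, (g + sq_incl K g'); rewrite tor_dD sq_incl_d -g'P.
have -> : sq_incl K (sq_part z - \sum_i c i *: w i) =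
    sq_incl K (sq_part z) - \sum_i c i *: sq_incl K (w i).
  rewrite raddfB raddf_sum; congr (_ - _); apply: eq_bigr => i _.
  by rewrite /= linearZ.
by rewrite -gP addrA [tor_d g + _]addrC subrK.
Qed.

(** [total_betti] is an [epsilon] choice, so a dimension has to be shown to exist; the finitely many
    indicator functions of pairs span. *)
Lemma total_betti_spec : is_quotient_dim Z B (total_betti F K).
Proof.
apply: epsilon_spec; apply: (quotient_dim_exists B_lin B0).
apply: (@incl_spans #|{: {set 'I_m} * {set 'I_m}}|
  (fun i => [ffun p => (p == enum_val i)%:R])) => z _ _.
exists (fun i => z (enum_val i)), 0; rewrite raddf0; apply/eqP; rewrite subr_eq0; apply/eqP.
apply/ffunP=> p; rewrite sum_ffunE (bigD1 (enum_rank p)) //= big1 => [|i].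
  by rewrite addr0 !ffunE enum_rankK eqxx; rewrite [_ *: _]mulr1.
move=> ip; rewrite !ffunE; case: eqP => [pE|_]; last by rewrite scaler0.
by rewrite pE enum_valK eqxx in ip.
Qed.

Let Z0 : Z 0.
Proof. exact: tor_d0. Qed.

Lemma total_betti_leq N (w : 'I_N -> D) :
  (forall z, supported K z -> sq_d z = 0 ->
    exists (c : 'I_N -> F) g, z - \sum_i c i *: w i = sq_d g) ->
  (total_betti F K <= N)%N.
Proof.
move=> /incl_spans wspan; have [b Zb [bfree _]] := quotient_dim_free B0 Z0 total_betti_spec.
exact: free_mod_leq Zb bfree wspan.
Qed.

(** A relation modulo boundaries is carried back to squarefree chains by [sq_part], a chain map and
    a left inverse of [sq_incl] on supported chains. *)
Lemma total_betti_geq r (z : 'I_r -> D) :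
  (forall i, supported K (z i)) -> (forall i, sq_d (z i) = 0) ->
  free_mod (fun f => exists g, f = sq_d g) z -> (r <= total_betti F K)%N.
Proof.
move=> sz dz zfree; have [b Zb [_ bspan]] := quotient_dim_free B0 Z0 total_betti_spec.
apply: (@free_mod_leq _ _ Z B B_lin B0 _ (fun i => sq_incl K (z i))) bspan => [i|c [g gP]].
  by rewrite /Z sq_incl_d dz raddf0.
apply: zfree; exists (sq_part g); rewrite -sq_part_d -gP raddf_sum.
by apply: eq_bigr => i _; rewrite /= linearZ /= sq_inclK.
Qed.

End TotalBettiSquarefree.

(** * Parity of dimensions and of set families *)

Lemma supported_vspace (F : fieldType) (P : finType) (X : {set P}) :
  exists2 U : {vspace {ffun P -> F^o}}, \dim U = #|X| &
    forall f, (f \in U) <-> (forall p, p \notin X -> f p = 0).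
Proof.
pose t : #|X|.-tuple {ffun P -> F^o} :=
  [tuple [ffun p => (p == enum_val i)%:R] | i < #|X|].
have tj (j : 'I_#|X|) : t`_j = [ffun p => (p == enum_val j)%:R].
  by rewrite -tnth_nth tnth_mktuple.
have tE (c : 'I_#|X| -> F) i : (\sum_j c j *: t`_j) (enum_val i) = c i.
  under eq_bigr do rewrite tj.
  rewrite sum_ffunE (bigD1 i) //= big1 => [|j ji]; rewrite !ffunE.
    by rewrite eqxx addr0 [_ *: _]mulr1.
  by rewrite (inj_eq enum_val_inj) eq_sym (negPf ji) scaler0.
have t_free : free t.
  by apply/freeP=> c c0 i; rewrite -tE c0 ffunE.
have t0 (c : 'I_#|X| -> F) p : p \notin X -> (\sum_j c j *: t`_j) p = 0.
  move=> pX; rewrite sum_ffunE big1 // => j _.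
  rewrite tj !ffunE; case: eqP => [pE|_]; last exact: scaler0.
  by rewrite pE enum_valP in pX.
exists <<t>>%VS => [|f]; first by move: t_free; rewrite /free size_tuple => /eqP.
split=> [/coord_span-> p|f0]; first exact: t0.
rewrite (_ : f = \sum_(i < #|X|) f (enum_val i) *: t`_i).
  apply: memv_suml => i _; apply: memvZ; apply: memv_span.
  by rewrite mem_nth // size_tuple.
apply/ffunP=> p; have [pX|pX] := boolP (p \in X); last by rewrite f0 // t0.
by rewrite -(enum_rankK_in pX pX) tE.
Qed.

(** Rank and nullity on [U] coincide, so the dimension is twice the rank. *)
Lemma exact_dim_even (F : fieldType) (V : vectType F) (f : 'End(V)) (U : {vspace V}) :
  (U :&: lker f)%VS = (f @: U)%VS -> ~~ odd (\dim U).
Proof. by move=> UE; rewrite -(limg_ker_dim f U) UE addnn odd_double. Qed.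

(** Adding or removing [s] pairs off the members of [Y]. *)
Lemma toggle_card_even (T : finType) (s : T) (Y : {set {set T}}) :
  (forall I : {set T}, (s |: I \in Y) = (I :\ s \in Y)) -> ~~ odd #|Y|.
Proof.
move=> Ys; rewrite -(cardsID [set I : {set T} | s \in I] Y).
have -> : Y :&: [set I : {set T} | s \in I] = [set s |: I | I in Y :\: [set I : {set T} | s \in I]].
  apply/setP=> I; apply/idP/imsetP; rewrite !inE.
    case/andP=> IY sI; exists (I :\ s); last by rewrite setD1K.
    by rewrite !inE eqxx -Ys (setUidPr _) ?sub1set.
  case=> J; rewrite !inE => /andP[sJ JY] ->; rewrite setU11 andbT Ys.
  by rewrite (_ : J :\ s = J) //; apply/setDidPl; rewrite disjoint_sym disjoints1.
rewrite card_in_imset ?addnn ?odd_double // => I J; rewrite !inE.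
move=> /andP[sI _] /andP[sJ _] /(congr1 (fun A => A :\ s)).
by rewrite !setU1K.
Qed.

(** * Lower bound from a facet *)

Section LowerBound.

Variables (F : fieldType) (m : nat) (K : simplicial_complex m).
Local Notation D := {ffun {set 'I_m} * {set 'I_m} -> F^o}.
Local Notation sq_d := (@sq_d F m K).

Variable s : {set 'I_m}.
Hypothesis sK : s \in faces K.
Hypothesis s_facet : forall t, t \in faces K -> s \subset t -> t = s.

(* Grading chains by the part of the multidegree outside the facet [s] amounts to
   inverting the variables of [s] in the resolution. *)
Definition outside (A : {set 'I_m}) : {set {set 'I_m} * {set 'I_m}} :=
  [set p | valid K p && ((p.1 :|: p.2) :\: s == A)].

(** The pairs are counted by [T]. Over [T = s] only [I = A] remains; over any other face, toggling
    in [I] an element of [s] outside [T] changes neither validity nor the trace outside [s]. *)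
Lemma odd_card_outside (A : {set 'I_m}) : [disjoint A & s] -> odd #|outside A|.
Proof.
move=> dis.
have -> : #|outside A| = (\sum_T #|[set I | (I, T) \in outside A]|)%N.
  rewrite -sum1_card big_mkcond.
  rewrite (eq_bigr (fun p => if (p.1, p.2) \in outside A then 1 else 0)%N) => [|[]//].
  rewrite -(pair_bigA _ (fun I T => if (I, T) \in outside A then 1 else 0)%N) /=.
  rewrite exchange_big; apply: eq_bigr => T _; rewrite -sum1_card -big_mkcond.
  by apply: eq_bigl => I; rewrite inE.
rewrite (bigD1 s) //= (_ : [set I | _] = [set A]).
  rewrite cards1 oddD /=.
  apply: (big_ind (fun n => ~~ odd n)) => // [x y /negPf xo /negPf yo|T Ts].
    by rewrite oddD xo yo.
  have [TK|TK] := boolP (T \in faces K); last first.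
    rewrite (_ : [set _ | _] = set0) ?cards0 //.
    by apply/setP=> I; rewrite !inE /valid /= (negPf TK) andbF.
  have /subsetPn[i si iT] : ~~ (s \subset T).
    by apply: contra Ts => /(s_facet TK) ->.
  apply: (@toggle_card_even _ i) => I; rewrite !inE /valid /= TK !andbT.
  congr (_ && _).
    rewrite -!setI_eq0; congr (_ == _); apply/setP=> j; rewrite !inE.
    by have [->|] := eqVneq j i; rewrite ?(negPf iT) ?andbF.
  congr (_ == _); apply/setP=> j; rewrite !inE.
  by have [->|] := eqVneq j i; rewrite ?si.
apply/setP=> I; rewrite !inE /valid /= sK andbT.
apply/andP/eqP => [[dI /eqP<-]|->]; last first.
  by rewrite dis; split=> //; rewrite setDUl setDv setU0; apply/eqP/setDidPl.
by rewrite setDUl setDv setU0; apply/esym/setDidPl.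
Qed.

Definition restrict (A : {set 'I_m}) (f : D) : D :=
  [ffun p => if p \in outside A then f p else 0].

Lemma restrict_linear A c f g : restrict A (c *: f + g) = c *: restrict A f + restrict A g.
Proof.
by apply/ffunP=> p; rewrite !ffunE; case: ifP; rewrite // scaler0 addr0.
Qed.

HB.instance Definition _ A :=
  GRing.isLinear.Build F D D _ (restrict A) (restrict_linear A).

(** The differential moves an element from [T] to [I], so it preserves their union, on which the
    grading depends. *)
Lemma restrict_d A f : restrict A (sq_d f) = sq_d (restrict A f).
Proof.
apply/ffunP=> -[I T]; rewrite !ffunE inE /=.
case: (boolP (valid K (I, T))) => [IT|_] /=; last by [].
case: ifP => IA.
  apply: eq_bigr => i iT; rewrite ffunE inE valid_move //=.
  rewrite (_ : _ :|: _ :\ i = I :|: T) ?IA //.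
  by apply/setP=> j; rewrite !inE; case: eqVneq => [->|]; rewrite ?iT ?orbT.
rewrite big1 // => i iT; rewrite ffunE inE valid_move //=.
rewrite (_ : _ :|: _ :\ i = I :|: T) ?IA ?mulr0 //.
by apply/setP=> j; rewrite !inE; case: eqVneq => [->|]; rewrite ?iT ?orbT.
Qed.

Lemma restrict_id A (f : D) : (forall p, p \notin outside A -> f p = 0) -> restrict A f = f.
Proof. by move=> f0; apply/ffunP=> p; rewrite ffunE; case: ifPn => // /f0. Qed.

Lemma restrict_outside A (f : D) p : p \notin outside A -> restrict A f p = 0.
Proof. by rewrite ffunE => /negPf->. Qed.

(** Exactness on the part graded by [A] would make its dimension even, but this dimension is the odd
    number [#|outside A|]. *)
Lemma nontrivial_cycle (A : {set 'I_m}) : [disjoint A & s] ->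
  exists z : D, [/\ forall p, p \notin outside A -> z p = 0, sq_d z = 0 &
    forall g, z <> sq_d g].
Proof.
move=> dis; apply: NNPP => noz.
have exact_d (z : D) : (forall p, p \notin outside A -> z p = 0) -> sq_d z = 0 ->
    exists g, z = sq_d g.
  by move=> z0 dz; apply: NNPP => nog; apply: noz; exists z; split=> // g zg; apply: nog; exists g.
have [U dimU UP] := supported_vspace F (outside A).
have := odd_card_outside dis; rewrite -dimU; apply/negP.
apply: (@exact_dim_even _ _ (linfun sq_d)); apply/vspaceP=> f.
apply/idP/idP.
  rewrite memv_cap memv_ker lfunE /= => /andP[/UP f0 /eqP df].
  have [g fg] := exact_d _ f0 df.
  (* [g] may have values outside the graded part; since [restrict] commutes with [sq_d], its
     restriction still has boundary [f]. *)
  rewrite -(restrict_id f0) fg restrict_d -[sq_d _](lfunE (sq_d : {linear D -> D})) memv_img //.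
  by apply/UP=> p; apply: restrict_outside.
case/memv_imgP=> g /UP g0 ->; rewrite lfunE /= memv_cap memv_ker lfunE /= sq_dd eqxx andbT.
by apply/UP; rewrite -(restrict_id g0) -restrict_d; apply: restrict_outside.
Qed.

(** Each subset of the complement of [s] gives one class. The classes have disjoint supports, so
    restricting a relation to one part isolates a single coefficient. *)
Lemma total_betti_facet : (2 ^ (m - #|s|) <= total_betti F K)%N.
Proof.
have -> : (2 ^ (m - #|s|))%N = #|powerset (~: s)|.
  by rewrite card_powerset [in RHS]cardsCs setCK card_ord.
have /fin_all_exists[z zP] (i : 'I_#|powerset (~: s)|) : exists z : D,
    [/\ forall p, p \notin outside (enum_val i) -> z p = 0, sq_d z = 0 &
    forall g, z <> sq_d g].
  by apply: nontrivial_cycle; have := enum_valP i; rewrite inE disjoints_subset.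
apply: (@total_betti_geq _ _ _ _ z) => [i p pK|i|c [g gP] i].
- by have [-> //] := zP i; rewrite inE (negPf pK).
- by have [] := zP i.
have [zi _ ncyc] := zP i.
apply/eqP/negPn/negP => ci; apply: (ncyc (restrict (enum_val i) ((c i)^-1 *: g))).
have /(congr1 (restrict (enum_val i))) := gP.
rewrite restrict_d raddf_sum (bigD1 i) //= big1 => [|j ji]; last first.
  rewrite linearZ /= (_ : restrict _ _ = 0) ?scaler0 //.
  apply/ffunP=> p; rewrite !ffunE; case: ifP => // ip; have [-> //] := zP j.
  apply: contra ji; rewrite inE => /andP[_ /eqP E].
  by move: ip; rewrite inE E => /andP[_]; rewrite (inj_eq enum_val_inj) .
rewrite addr0 linearZ /= restrict_id // => E.
by rewrite linearZ /= linearZ /= -E scalerA mulVf // scale1r.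
Qed.

End LowerBound.

(** * Contracting squarefree chains along one vertex *)

Section Contraction.

Variables (F : fieldType) (m : nat) (K : simplicial_complex m).
Local Notation sgn := (@koszul_sign m F).
Local Notation D := {ffun {set 'I_m} * {set 'I_m} -> F^o}.
Local Notation sq_d := (@sq_d F m K).

(** The homotopy moves [w] from [T] into [I]. It cancels the terms with [w \in T] and, by the cycle
    equation, those with [w \in I] for which [w |: T] is a face. The last clause traces each
    surviving term to its origin, so that effects of earlier contractions can be followed. *)
Lemma sq_step (w : 'I_m) (z : D) : sq_d z = 0 ->
  exists g, forall I T, valid K (I, T) -> (z - sq_d g) (I, T) != 0 ->
    [/\ w \notin T, w \in I -> w |: T \notin faces K &
      z (I, T) != 0 \/
      w \in I /\ exists2 i, i \in T & z (i |: I :\ w, w |: T :\ i) != 0].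
Proof.
move=> dz.
pose g : D := [ffun p : {set 'I_m} * {set 'I_m} =>
  if w \in p.1 then sgn (p.1 :\ w) w * z (p.1 :\ w, w |: p.2) else 0].
have gE I T : sq_d g (I, T) = if valid K (I, T) then \sum_(i in T)
    sgn I i * (if w \in i |: I then sgn ((i |: I) :\ w) w *
      z ((i |: I) :\ w, w |: T :\ i) else 0) else 0.
  by rewrite ffunE; case: ifP => // _; apply: eq_bigr => i _; rewrite ffunE.
exists g => I T IT; rewrite ffunBE gE IT; have /andP[/= dis TK] := IT.
have [wT|wT] := boolP (w \in T).
  have wI : w \notin I by rewrite (disjointFl dis wT).
  rewrite (bigD1 w) //= big1 => [|i /andP[_ iw]]; last first.
    by rewrite !inE eq_sym (negPf iw) (negPf wI) mulr0.
  by rewrite setU11 setU1K // setD1K // addr0 mulrA koszul_sign_sqr mul1r subrr eqxx.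
have [wI|wI] := boolP (w \in I); last first.
  rewrite big1 ?subr0 => [zIT|i iT]; first by split=> //; left.
  rewrite !inE (negPf wI) orbF; case: eqP => [wi|_]; last by rewrite mulr0.
  by rewrite wi iT in wT.
have sumE : \sum_(i in T) sgn I i * (if w \in i |: I then sgn ((i |: I) :\ w) w *
      z ((i |: I) :\ w, w |: T :\ i) else 0) =
    - (sgn (I :\ w) w *
        \sum_(i in T) sgn (I :\ w) i * z (i |: I :\ w, w |: T :\ i)).
  rewrite mulr_sumr -sumrN; apply: eq_bigr => i iT.
  have iI : i \notin I by rewrite (disjointFl dis iT).
  have iw : i != w by apply: contraNneq iI => ->.
  have -> : (i |: I) :\ w = i |: I :\ w.
    by apply/setP=> j; rewrite !inE; case: (eqVneq j i) => [->|//]; rewrite iw.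
  rewrite setU1r // mulrA koszul_sign_swap // mulNr.
  by rewrite [sgn _ i * _]mulrC -mulrA.
rewrite sumE opprK; have [wTK|wTK] := boolP (w |: T \in faces K).
  suff -> : z (I, T) = - (sgn (I :\ w) w *
        \sum_(i in T) sgn (I :\ w) i * z (i |: I :\ w, w |: T :\ i)).
    by rewrite addNr eqxx.
  (* The cycle equation at this pair is solved for its summand [i = w], which is [z (I, T)] up to
     sign. *)
  have /ffunP/(_ (I :\ w, w |: T)) := dz; rewrite !ffunE /valid /= wTK andbT.
  rewrite ifT; last first.
    rewrite -setI_eq0; apply/set0Pn=> -[j]; rewrite !inE => /andP[/andP[/negPf-> jI]] /= jT.
    by rewrite (disjointFr dis jI) in jT.
  rewrite (bigD1 w) ?setU11 //= setD1K // setU1K // => /(canRL (addrK _)).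
  rewrite sub0r => /(congr1 (fun x => sgn (I :\ w) w * x)).
  rewrite mulrA koszul_sign_sqr mul1r => ->; rewrite mulrN; congr (- (_ * _)).
  apply: eq_big => [i|i]; rewrite !inE.
    have [->|_] := eqVneq i w; rewrite ?(negPf wT) ?andbT //.
  case: eqP => [//|/eqP iw] /=; rewrite andbT => iT; congr (_ * z (_, _)).
  by apply/setP=> j; rewrite !inE; case: (eqVneq j w) => [->|//]; rewrite eq_sym iw.
move=> nz; split=> //.
have [z0|] := eqVneq (z (I, T)) 0; last by left.
right; split=> //; apply: NNPP => nex; case/negP: nz.
rewrite z0 add0r big1 ?mulr0 // => i iT.
have [->|zi] := eqVneq (z (i |: I :\ w, w |: T :\ i)) 0; first by rewrite mulr0.
by case: nex; exists i.
Qed.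

End Contraction.

(** * The join of 0-spheres with a simplex *)

Section CrossPolytope.

Variables (m k : nat).
Hypothesis km : (k.*2 <= m)%N.

Definition cross_faces : {set {set 'I_m}} :=
  [set T : {set 'I_m} |
    [forall w : 'I_m, (w < k)%N ==> ~~ ((w \in T) && (rev_ord w \in T))]].

(** By [km] the partners of the vertices below [k] are not below [k], so the pairs are disjoint and
    each has two distinct vertices. *)
Lemma rev_ord_lt (w : 'I_m) : (w < k)%N -> (k <= rev_ord w)%N.
Proof. by rewrite /=; move: (ltn_ord w) km; rewrite -addnn; lia. Qed.

Lemma cross_face0 : set0 \in cross_faces.
Proof. by rewrite inE; apply/forallP=> w; rewrite inE implybT. Qed.

Lemma cross_face1 i : [set i] \in cross_faces.
Proof.
rewrite inE; apply/forallP=> w; apply/implyP=> wk; rewrite !inE.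
apply/negP=> /andP[/eqP<- /eqP wE].
by have := rev_ord_lt wk; rewrite wE leqNgt wk.
Qed.

Lemma cross_face_sub (s t : {set 'I_m}) :
  t \subset s -> s \in cross_faces -> t \in cross_faces.
Proof.
move=> /subsetP ts; rewrite !inE => /forallP sK; apply/forallP=> w; apply/implyP=> wk.
by have /implyP/(_ wk) := sK w; apply: contra => /andP[/ts-> /ts->].
Qed.

Definition cross_complex : simplicial_complex m :=
  SimplicialComplex cross_face0 cross_face1 cross_face_sub.

Lemma card_ord_lt : #|[set w : 'I_m | (w < k)%N]| = k.
Proof.
have le_km : (k <= m)%N by lia.
rewrite -sum1dep_card -(big_ord_widen _ (fun=> 1%N) le_km).
by rewrite sum1_card card_ord.
Qed.

(** [f w] is a vertex of the pair of [w] that [T] misses; disjointness of the pairs makes [f]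
    injective on [w < k]. *)
Lemma cross_face_card T : T \in cross_faces -> (#|T| <= m - k)%N.
Proof.
rewrite inE => /forallP TK.
pose f (w : 'I_m) := if w \in T then rev_ord w else w.
suff : (k <= #|~: T|)%N.
  by have := cardsC T; rewrite card_ord; lia.
rewrite -[X in (X <= _)%N]card_ord_lt -(card_in_imset (f := f)); last first.
  move=> v w; rewrite !inE /f => vk wk.
  case: ifP => _; case: ifP => _ //; first exact: rev_ord_inj.
    by move=> vw; have := rev_ord_lt vk; rewrite vw leqNgt wk.
  by move=> vw; have := rev_ord_lt wk; rewrite -vw leqNgt vk.
apply/subset_leq_card/subsetP=> _ /imsetP[w + ->]; rewrite !inE /f => wk.
by have /implyP/(_ wk) := TK w; case: ifP => //= ->.
Qed.

Lemma cross_cdim : cdim cross_complex = (m - k)%:Z - 1.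
Proof.
rewrite /cdim; congr (_%:Z - 1); apply/eqP; rewrite eqn_leq; apply/andP; split.
  by apply/bigmax_leqP=> T; apply: cross_face_card.
(* This face omits only the lower vertex of each pair and attains the bound. *)
have TK : ~: [set w : 'I_m | (w < k)%N] \in cross_faces.
  by rewrite inE; apply/forallP=> w; apply/implyP=> wk; rewrite !inE wk.
apply: leq_trans (leq_bigmax_cond _ TK).
by rewrite -[X in (_ <= X)%N](addKn #|[set w : 'I_m | (w < k)%N]|) cardsC card_ord card_ord_lt.
Qed.

Lemma cross_nonface (w : 'I_m) (T : {set 'I_m}) : T \in cross_faces ->
  w |: T \notin cross_faces ->
  rev_ord w \in T /\ ((w < k)%N || (rev_ord w < k)%N).
Proof.
move=> TK; rewrite inE => /forallPn[v]; rewrite negb_imply negbK => /and3P[vk].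
have : ~~ ((v \in T) && (rev_ord v \in T)).
  by move: TK; rewrite inE => /forallP/(_ v)/implyP; apply.
rewrite !inE; case: (eqVneq v w) => [<- nT _|_ nT]; rewrite ?orTb ?orFb.
  case/orP=> [/eqP rv|->]; last by rewrite vk.
  by have := rev_ord_lt vk; rewrite rv leqNgt vk.
move=> vT; move: nT; rewrite vT andTb => /negPf->; rewrite orbF => /eqP rv.
by rewrite -rv rev_ordK vT vk orbT.
Qed.

Variable F : fieldType.
Local Notation D := {ffun {set 'I_m} * {set 'I_m} -> F^o}.
Local Notation K := cross_complex.
Local Notation sq_d := (@sq_d F m K).

(** The element exchanged in [sq_step] must be [rev_ord w]: only its removal can turn the nonface
    [w |: T] into a face, since [T] contains the partner of [w]. *)
Lemma cross_step (w : 'I_m) (z : D) : supported K z -> sq_d z = 0 ->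
  exists g, forall I T, (z - sq_d g) (I, T) != 0 ->
    [/\ w \notin T,
        w \in I -> rev_ord w \in T /\ ((w < k)%N || (rev_ord w < k)%N) &
        z (I, T) != 0 \/
        w \in I /\ z (rev_ord w |: I :\ w, w |: T :\ rev_ord w) != 0].
Proof.
move=> sz dz; have [g gP] := sq_step w dz; exists g => I T nz.
have IT : valid K (I, T).
  by apply: contraNT nz => IT; rewrite ffunBE sz // sq_d_supported // subrr.
have [wT wI zP] := gP I T IT nz; have /andP[/= _ TK] := IT.
split=> // [/wI|]; first exact: cross_nonface.
case: zP => [|[/[dup] wI' /wI nK [i iT zi]]]; [by left | right; split=> //].
have [rT rk] := cross_nonface TK nK.
suff <- : i = rev_ord w by [].
apply/eqP/negPn/negP=> ir.
have /andP[/= _ ] : valid K (i |: I :\ w, w |: T :\ i).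
  by apply: contraNT zi => /sz->.
rewrite inE => /forallP h.
have wi : w != i by apply: contraNneq wT => ->.
have rT' : rev_ord w \in w |: T :\ i by rewrite !inE [_ == i]eq_sym ir rT orbT.
case/orP: rk => rk.
  by have /implyP/(_ rk) := h w; rewrite rT' setU11.
by have /implyP/(_ rk) := h (rev_ord w); rewrite rT' rev_ordK setU11.
Qed.

(* [half_reduced] holds on the support after contracting along v >= k, and
   [reduced] once rev_ord w and then w have both been contracted. *)
Definition half_reduced (p : {set 'I_m} * {set 'I_m}) (v : 'I_m) :=
  (v \notin p.2) && ((v \in p.1) ==> (rev_ord v < k)%N && (rev_ord v \in p.2)).

Definition reduced (p : {set 'I_m} * {set 'I_m}) (w : 'I_m) :=
  [&& w \notin p.2, rev_ord w \notin p.1 & (w \in p.1) == (rev_ord w \in p.2)].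

Lemma rev_neq (v w : 'I_m) : (k <= v)%N -> (rev_ord w < k)%N -> v != rev_ord w.
Proof. by move=> kv wk; apply: contraTneq kv => ->; rewrite leqNgt wk. Qed.

(** The vertices [v >= k] are contracted one by one. The exchange at a later [w] touches only [w]
    and [rev_ord w < k], and both [v] and a partner [rev_ord v < k] differ from these, so
    [half_reduced] persists at [v]. *)
Lemma cross_half (z : D) : supported K z -> sq_d z = 0 ->
  exists g, forall p, (z - sq_d g) p != 0 ->
    forall v : 'I_m, (k <= v)%N -> half_reduced p v.
Proof.
move=> sz dz; suff [g gP] : exists g, forall p, (z - sq_d g) p != 0 ->
    forall v, v \in enum [set v : 'I_m | (k <= v)%N] -> half_reduced p v.
  by exists g => p /gP h v kv; apply: h; rewrite mem_enum inE.
have : {subset enum [set v : 'I_m | (k <= v)%N] <= [set v : 'I_m | (k <= v)%N]}.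
  by move=> v; rewrite mem_enum.
elim: (enum _) => [|w s IH] sk; first by exists 0 => p _ v.
have [v vs|g gP] := IH; first by apply: sk; rewrite inE vs orbT.
have kw : (k <= w)%N by have := sk w (mem_head _ _); rewrite inE.
have sz' : supported K (z - sq_d g).
  by move=> p pK; rewrite ffunBE sz // sq_d_supported // subrr.
have dz' : sq_d (z - sq_d g) = 0 by rewrite raddfB /= dz sq_dd subrr.
have [g' g'P] := cross_step w sz' dz'.
exists (g + g') => -[I T]; rewrite raddfD /= opprD addrA => /g'P[wT wI zP] v.
have [-> _|vw] := eqVneq v w.
  rewrite /half_reduced /= wT; apply/implyP=> /wI[-> /orP[|->//]].
  by rewrite ltnNge kw.
rewrite inE (negPf vw) /= => vs.
have kv : (k <= v)%N by have := sk v; rewrite !inE vs orbT; apply.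
case: zP => [/gP/(_ v vs)//|[wI' /gP/(_ v vs)]].
have [rT] := wI wI'; rewrite ltnNge kw /= => rk.
have vr := rev_neq kv rk.
rewrite /half_reduced /= !inE (negPf vw) (negPf vr) /= => /andP[-> /implyP vP].
apply/implyP=> /vP /andP[rvk]; rewrite rvk (inj_eq rev_ord_inj) (negPf vw) /=.
have -> : rev_ord v == w = false.
  apply: contraTF rvk => /eqP rv.
  by rewrite -[(m - v.+1)%N]/(val (rev_ord v)) rv -leqNgt.
by [].
Qed.

(** After [cross_half], the vertices below [k] are contracted; those still waiting retain
    [half_reduced] at their partners. *)
Lemma cross_reduce (z : D) : supported K z -> sq_d z = 0 ->
  exists g, forall p, (z - sq_d g) p != 0 ->
    [/\ forall v : 'I_m, (k <= v)%N -> (k <= rev_ord v)%N -> half_reduced p v &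
      forall w : 'I_m, (w < k)%N -> reduced p w].
Proof.
move=> sz dz; suff [g gP] : exists g, forall p, (z - sq_d g) p != 0 ->
    [/\ forall v : 'I_m, (k <= v)%N -> (k <= rev_ord v)%N -> half_reduced p v &
      forall w : 'I_m, (w < k)%N ->
      if w \in enum [set w : 'I_m | (w < k)%N] then reduced p w
      else half_reduced p (rev_ord w)].
  exists g => p /gP[h1 h2]; split=> // w wk.
  by have := h2 w wk; rewrite mem_enum inE wk.
have : {subset enum [set w : 'I_m | (w < k)%N] <= [set w : 'I_m | (w < k)%N]}.
  by move=> v; rewrite mem_enum.
have := enum_uniq [set w : 'I_m | (w < k)%N].
elim: (enum _) => [|w s IH]; last rewrite cons_uniq.
  have [g gP] := cross_half sz dz.
  move=> _ _; exists g => p /gP h; split=> [v kv _|w wk]; first exact: h.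
  by rewrite in_nil; apply: h; apply: rev_ord_lt.
move=> /andP[ws us] sk.
have [//|v vs|g gP] := IH; first by apply: sk; rewrite inE vs orbT.
have wk : (w < k)%N by have := sk w (mem_head _ _); rewrite inE.
have sz' : supported K (z - sq_d g).
  by move=> p pK; rewrite ffunBE sz // sq_d_supported // subrr.
have dz' : sq_d (z - sq_d g) = 0 by rewrite raddfB /= dz sq_dd subrr.
have [g' g'P] := cross_step w sz' dz'.
exists (g + g') => -[I T]; rewrite raddfD /= opprD addrA => nz.
have /andP[/= dis _] : valid K (I, T).
  apply: contraNT nz => IT; rewrite 2!ffunBE sz // !sq_d_supported // !subr0 //.
have [wT wI zP] := g'P _ _ nz.
(* [q] is a term from which the one at [(I, T)] stems; the two agree outside the pair of [w], so the
   conditions at other vertices transfer. *)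
have [q zq qP] : exists2 q, (z - sq_d g) q != 0 & forall v, v != w -> v != rev_ord w ->
    (v \in q.1) = (v \in I) /\ (v \in q.2) = (v \in T).
  case: zP => [zIT|[_ zq]]; first by exists (I, T).
  exists (rev_ord w |: I :\ w, w |: T :\ rev_ord w) => // v vw vr.
  by rewrite !inE (negPf vw) (negPf vr).
have [q1 q2] := gP q zq.
have krw := rev_ord_lt wk.
split=> [v kv krv|u uk].
  have vw : v != w by apply: contraTneq kv => ->; rewrite -ltnNge.
  have vr : v != rev_ord w.
    apply/negP=> /eqP vr; have : (k <= rev_ord v)%N by exact: krv.
    by rewrite vr rev_ordK leqNgt wk.
  have := q1 v kv krv; rewrite /half_reduced.
  have krv': (rev_ord v < k)%N = false by rewrite ltnNge krv.
  by have [-> ->] := qP v vw vr; rewrite krv'.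
(* If [w \in I], its partner lies in [T]. Otherwise the term is an old one, and [half_reduced] at
   the partner, with [w \notin T], excludes the partner from both sets. *)
have [->|uw] := eqVneq u w.
  rewrite mem_head /reduced /= wT /=.
  case: (boolP (w \in I)) => [/[dup] wI' /wI[rT _]|wI'].
    by rewrite rT (disjointFl dis rT).
  case: zP => [zIT|[]]; last by rewrite (negPf wI').
  have [_ /(_ w wk)] := gP _ zIT; rewrite (negPf ws) /half_reduced /=.
  rewrite rev_ordK (negPf wT) andbF implybF => /andP[/negPf-> ->].
  by [].
rewrite inE (negPf uw) /=.
have ur : u != rev_ord w by apply: contraTneq uk => ->; rewrite -leqNgt.
have ru : rev_ord u != w by apply: contraTneq wk => <-; rewrite -leqNgt rev_ord_lt.
have rr : rev_ord u != rev_ord w by rewrite (inj_eq rev_ord_inj).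
have := q2 u uk; rewrite /reduced /half_reduced rev_ordK /=.
by have [-> ->] := qP u uw ur; have [-> ->] := qP _ ru rr.
Qed.

(** Vertices in no pair occur in neither set. In a pair, the lower vertex is never in [T], the upper
    one never in [I], and the upper one is in [T] exactly when the lower one is in [I]. *)
Lemma reduced_critical (I T : {set 'I_m}) :
  (forall v : 'I_m, (k <= v)%N -> (k <= rev_ord v)%N -> half_reduced (I, T) v) ->
  (forall w : 'I_m, (w < k)%N -> reduced (I, T) w) ->
  I \in powerset [set w : 'I_m | (w < k)%N] /\ T = [set rev_ord w | w in I].
Proof.
move=> h1 h2.
have middle (v : 'I_m) : (k <= v)%N -> (k <= rev_ord v)%N -> v \notin I /\ v \notin T.
  move=> kv krv; have := h1 v kv krv; rewrite /half_reduced ltnNge krv /=.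
  by case/andP=> -> /=; rewrite implybF.
have Ik (v : 'I_m) : v \in I -> (v < k)%N.
  move=> vI; rewrite ltnNge; apply/negP=> kv.
  have [rvk|krv] := ltnP (rev_ord v) k.
    by have /and3P[_] := h2 _ rvk; rewrite rev_ordK /= vI.
  by have [] := middle v kv krv; rewrite vI.
split; first by rewrite inE; apply/subsetP=> v /Ik; rewrite inE.
apply/setP=> v; rewrite -[v in RHS]rev_ordK mem_imset; last exact: rev_ord_inj.
have [rvk|krv] := ltnP (rev_ord v) k; first
  by have /and3P[_ _ /eqP->] := h2 _ rvk; rewrite rev_ordK.
have /negPf-> : rev_ord v \notin I.
  by apply/negP=> /Ik; rewrite ltnNge krv.
have [vk|kv] := ltnP v k; first by have /and3P[/negPf] := h2 _ vk.
by have [_ /negPf] := middle v kv krv.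
Qed.

Lemma cross_betti : (total_betti F K <= 2 ^ k)%N.
Proof.
pose Y := powerset [set w : 'I_m | (w < k)%N].
have <- : #|Y| = (2 ^ k)%N by rewrite card_powerset card_ord_lt.
pose crit (I : {set 'I_m}) := (I, [set rev_ord w | w in I]).
pose e (i : 'I_#|Y|) : D := [ffun p => (p == crit (enum_val i))%:R].
apply: (@total_betti_leq _ _ _ _ e) => z sz dz.
have [g gP] := cross_reduce sz dz.
(* The coefficients are the values of the reduced chain at the critical pairs, the only places where
   it can be nonzero. *)
exists (fun i => (z - sq_d g) (crit (enum_val i))), g.
suff {1}-> : z = sq_d g + \sum_i (z - sq_d g) (crit (enum_val i)) *: e i.
  by rewrite addrK.
apply/eqP; rewrite addrC -subr_eq; apply/eqP; move: (z - sq_d g) gP => z' gP.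
apply/ffunP=> -[I T]; rewrite sum_ffunE.
have [IT|IT] := boolP ((I \in Y) && (T == [set rev_ord w | w in I])).
  have /andP[IY /eqP->] := IT; rewrite -/(crit I).
  rewrite (bigD1 (enum_rank_in IY I)) //= big1 => [|j ji]; last first.
    rewrite !ffunE; case: eqP => [[IE _]|_]; last exact: scaler0.
    case/negP: ji; apply/eqP/enum_val_inj; rewrite enum_rankK_in //.
  by rewrite !ffunE enum_rankK_in // eqxx addr0 [_ *: _]mulr1.
rewrite big1 => [|j _]; last first.
  rewrite !ffunE; case: eqP => [[IE TE]|_]; last exact: scaler0.
  by case/negP: IT; rewrite TE IE enum_valP eqxx.
apply/eqP; apply: contraNT IT => /gP[h1 h2].
by have [IY ->] := reduced_critical h1 h2; rewrite IY eqxx.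
Qed.

End CrossPolytope.

(** * Comparison of the two bounds *)

Lemma total_betti_lower (F : fieldType) (m : nat) (K : simplicial_complex m) :
  (2 ^ absz (m%:Z - cdim K - 1)%R <= total_betti F K)%N.
Proof.
have [s sK smax] : exists2 s, s \in faces K &
    (\max_(t in faces K) #|t|)%N = #|s|.
  have K0 : (0 < #|faces K|)%N by apply/card_gt0P; exists set0; apply: face0.
  have [s sK ->] := eq_bigmax_cond (fun t : {set 'I_m} => #|t|) K0.
  by exists s.
have sm : (#|s| <= m)%N by have := max_card s; rewrite card_ord.
have -> : absz (m%:Z - cdim K - 1)%R = (m - #|s|)%N by rewrite /cdim smax; lia.
(* A face of maximal size is maximal under inclusion. *)
apply: total_betti_facet => // t tK st; apply/eqP; rewrite eq_sym eqEcard st -smax.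
exact: leq_bigmax_cond.
Qed.

Theorem corollary1p8 (F : fieldType) (m : nat) (d : int)
  (hd1 : ((m%:Z - 1) %/ 2)%Z <= d) (hd2 : d <= m%:Z - 1) :
  forall K : simplicial_complex m,
    D_minimal F d K <-> (in_Sigma d K /\ taut F K).
Proof.
move=> K; pose k := absz (m%:Z - d - 1)%R.
(* By [hd1], [k <= m - 1 - [(m-1)/2] <= m/2]; for [m = 0] the floor is [-1], whence [d = -1] and
   [k = 0]. *)
have km : (k.*2 <= m)%N by rewrite /k -addnn; lia.
split=> [[dK Kmin]|[dK tK]].
  split=> //; apply/eqP; rewrite eqn_leq total_betti_lower andbT dK.
  (* Minimality is tested against [cross_complex], whose dimension [m - k - 1] is [d]. *)
  apply: leq_trans (cross_betti km F); apply: Kmin.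
  by rewrite /in_Sigma cross_cdim /k; lia.
split=> // L dL; rewrite tK dK -dL; exact: total_betti_lower.
Qed.
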